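(* Let $F \subseteq \mathbb{R}^d$ be any non-empty set and let $1 \leq k < d$ be an integer. Then $$\dim_{\mathrm{A}} \pi F \ \geq\ \min\{k, \dim_{\mathrm{A}} F\}$$ for almost all $\pi \in G_{d,k}$.
   Context: For integers $1 \leq k < d$, $G_{d,k}$ is the Grassmannian manifold of $k$-dimensional linear subspaces of $\mathbb{R}^d$; each subspace $V$ is identified with the orthogonal projection $\pi : \mathbb{R}^d \to V$, so elements of $G_{d,k}$ are regarded as orthogonal projections. $G_{d,k}$ is a smooth manifold of dimension $k(d-k)$ and ''almost all'' is with respect to its natural ($k(d-k)$-dimensional, rotation-invariant) analogue of Lebesgue measure. $\pi F = \pi(F)$ is the image of $F$. For a non-empty bounded set $E \subset \mathbb{R}^d$ and $r>0$, $N_r(E)$ is the smallest number of open sets of diameter at most $r$ required to cover $E$. The Assouad dimension of a non-empty set $F \subseteq \mathbb{R}^d$ is $$\dim_{\mathrm{A}} F = \inf\Big\{ s \geq 0 : (\exists C>0)(\forall R>0)(\forall r \in (0,R))(\forall x \in F)\ N_r(B(x,R)\cap F) \leq C (R/r)^s \Big\},$$ where $B(x,R)$ is the closed ball with centre $x$ and radius $R$. *)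

(* Defs.v *)
From HB Require Import structures.
From mathcomp Require Import all_boot all_order all_algebra.
From mathcomp Require Import all_classical all_reals all_analysis.

Set Implicit Arguments.
Unset Strict Implicit.
Unset Printing Implicit Defensive.

Import Order.TTheory GRing.Theory Num.Theory.
Import numFieldNormedType.Exports.

Local Open Scope classical_set_scope.
Local Open Scope ring_scope.

Section Assouad.
Context {R : realType} {d : nat}.
Implicit Types (x y : 'cV[R]_d) (E F U : set 'cV[R]_d).

(* The library norm on matrices is the sup norm; it induces the same open sets
   as [enorm] but different balls and diameters. *)
Definition enorm x : R := Num.sqrt (\sum_(i < d) x i 0 ^+ 2).

Definition eball x (r : R) : set 'cV[R]_d := [set y | enorm (y - x) <= r].

Definition diam_le U (r : R) : Prop :=
  forall x y, U x -> U y -> enorm (x - y) <= r.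

Definition coverable (r : R) E (n : nat) : Prop :=
  exists U : 'I_n -> set 'cV[R]_d,
    (forall i, open (U i) /\ diam_le (U i) r) /\ E `<=` \bigcup_i U i.

(* Valued in [\bar R], so that it is +oo (and not a default value) when no
   finite cover exists. *)
Definition covering_number (r : R) E : \bar R :=
  ereal_inf [set (n%:R : R)%:E | n in coverable r E].

Definition assouad_dim F : \bar R :=
  ereal_inf [set s%:E | s in [set s : R | 0 <= s /\
    exists2 C : R, 0 < C &
      forall rho r : R, 0 < r < rho -> forall x, F x ->
        (covering_number r (eball x rho `&` F)
           <= (C * (rho / r) `^ s)%:E)%E]].

End Assouad.

Section Grassmannian.
Context (R : realType).

(* G_{d,k}: each subspace is represented by the matrix, acting on column
   vectors, of the orthogonal projection onto it. *)
Definition grassmannian (d k : nat) : set 'M[R]_d :=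
  [set P | [/\ P *m P = P, P^T = P & \rank P = k]].

Arguments grassmannian d k _ : clear implicits.

Definition proj_image (d : nat) (P : 'M[R]_d) (F : set 'cV[R]_d)
  : set 'cV[R]_d := [set P *m x | x in F].

Definition rotation (d : nat) : set 'M[R]_d :=
  [set g | g *m g^T = 1%:M /\ \det g = 1].

Arguments rotation d _ : clear implicits.

Definition borel_mx (d : nat) := g_sigma_algebraType (@open 'M[R]_d).

(* The natural measure on G_{d,k} is, after normalisation, the unique Borel
   probability measure on it invariant under V |-> g V for all rotations g.
   If P is the projection onto V then g P g^T is the projection onto g V.
   Borel measures on G_{d,k} are encoded as Borel measures on the ambient
   matrix space that are carried by the closed set G_{d,k}. *)
Definition grassmannian_measure (d k : nat)
    (gamma : probability (borel_mx d) R) : Prop :=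
  gamma (grassmannian d k) = 1%E /\
  forall g : 'M[R]_d, rotation d g ->
    forall A : set (borel_mx d), measurable A ->
      gamma [set g *m (P : 'M[R]_d) *m g^T | P in A] = gamma A.

End Grassmannian.

Arguments grassmannian {R} d k _.
Arguments rotation {R} d _.
Arguments borel_mx R d : clear implicits.
Arguments grassmannian_measure {R} d k gamma.

(* Main.v *)
(** Weak tangents and Hausdorff dimension are avoided by working at a single
    pair of scales.  If s < dim_A F, there are separations r and finite
    r/2-separated subsets of F with too many points; maximising the density
    #(A ∩ B(x, 2^h r)) / 2^(hs) over centres and scales yields a ball of radius
    2^l r, with l arbitrarily large, in which the normalised counting measure is
    Frostman of exponent s down to scale r.  If moreover s < k, the bound
    gamma {P : |P v| <= r} <= K (r / |v|)^k shows that the expected number of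
    pairs of points whose projections are r-close is O(n^2 2^(-ls)) among n
    points, so by Markov's inequality and Cauchy-Schwarz the projection needs
    2^(lt) sets of diameter r, for t < s, outside a set of P of measure
    O(2^(-l(s-t))).  Almost every P is good for infinitely many l.

    The bound on gamma follows from rotation invariance alone, by averaging over
    rotates of v in the directions of integer points: at most O(n^(d-k)) of the
    points of {1, ..., n}^d lie within a bounded distance of a subspace of
    dimension d - k. *)

Require Import Defs.
From mathcomp Require Import all_boot all_order all_algebra.
From mathcomp Require Import all_classical all_reals all_analysis.
From mathcomp Require Import measurable_realfun.
From mathcomp Require Import ring lra zify.

Set Implicit Arguments.
Unset Strict Implicit.
Unset Printing Implicit Defensive.

Import Order.TTheory GRing.Theory Num.Theory.
Import numFieldNormedType.Exports.

Local Open Scope classical_set_scope.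
Local Open Scope ring_scope.

(** * Euclidean norm and rotations *)

(** Lagrange's identity: the squares of all [f i * g j - f j * g i] add up to twice the difference
    of the two sides. *)
Lemma sum_Cauchy_Schwarz (R : realDomainType) (T : finType) (f g : T -> R) :
  (\sum_i f i * g i) ^+ 2 <= (\sum_i f i ^+ 2) * (\sum_i g i ^+ 2).
Proof.
have : 0 <= \sum_i \sum_j (f i * g j - f j * g i) ^+ 2.
  by apply: sumr_ge0 => i _; apply: sumr_ge0 => j _; exact: sqr_ge0.
have -> : \sum_i \sum_j (f i * g j - f j * g i) ^+ 2 =
    ((\sum_i f i ^+ 2) * (\sum_i g i ^+ 2) - (\sum_i f i * g i) ^+ 2) *+ 2.
  transitivity (\sum_i \sum_j (f i ^+ 2 * g j ^+ 2 + g i ^+ 2 * f j ^+ 2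
      - (f i * g i) * (f j * g j) *+ 2)).
    by apply: eq_bigr => i _; apply: eq_bigr => j _; ring.
  transitivity (\sum_i (f i ^+ 2 * (\sum_j g j ^+ 2)
      + g i ^+ 2 * (\sum_j f j ^+ 2) - f i * g i * (\sum_j f j * g j) *+ 2)).
    by apply: eq_bigr => i _; rewrite !big_split /= sumrN sumrMnl -!mulr_sumr.
  by rewrite !big_split /= sumrN sumrMnl -!mulr_suml; ring.
by rewrite pmulrn_lge0// subr_ge0.
Qed.

Section Euclidean.
Context {R : realType} {d : nat}.
Implicit Types (x y z : 'cV[R]_d) (A : 'M[R]_d).

Lemma dotE x y : (x^T *m y) 0 0 = \sum_i x i 0 * y i 0.
Proof. by rewrite mxE; apply: eq_bigr => i _; rewrite mxE. Qed.

Lemma enorm_sqr x : enorm x ^+ 2 = (x^T *m x) 0 0.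
Proof.
rewrite dotE sqr_sqrtr; first by under eq_bigr do rewrite expr2.
by apply: sumr_ge0 => i _; exact: sqr_ge0.
Qed.

Lemma enorm_ge0 x : 0 <= enorm x.
Proof. exact: sqrtr_ge0. Qed.

Lemma enormZ a x : enorm (a *: x) = `|a| * enorm x.
Proof.
apply/eqP; rewrite -(@eqrXn2 _ 2) ?mulr_ge0 ?enorm_ge0// exprMn !enorm_sqr.
rewrite real_normK ?num_real// !dotE mulr_sumr; apply/eqP/eq_bigr => i _.
by rewrite !mxE; ring.
Qed.

Lemma enormN x : enorm (- x) = enorm x.
Proof. by rewrite -scaleN1r enormZ normrN1 mul1r. Qed.

Lemma enorm0 : enorm (0 : 'cV[R]_d) = 0.
Proof. by rewrite -(scale0r 0) enormZ normr0 mul0r. Qed.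

Lemma enorm_eq0 x : (enorm x == 0) = (x == 0).
Proof.
apply/eqP/eqP => [x0|->]; last exact: enorm0.
have /eqP : \sum_i x i 0 ^+ 2 = 0.
  transitivity (enorm x ^+ 2); last by rewrite x0 expr0n.
  by rewrite enorm_sqr dotE; apply: eq_bigr => i _; rewrite expr2.
rewrite psumr_eq0 => [/allP xi0|i _]; last exact: sqr_ge0.
apply/matrixP => i j; rewrite (ord1 j) [RHS]mxE; apply/eqP.
by rewrite -sqrf_eq0; apply: (implyP (xi0 i _)) => //; exact: mem_index_enum.
Qed.

Lemma dot_le x y : (x^T *m y) 0 0 <= enorm x * enorm y.
Proof.
rewrite (le_trans (ler_norm _))// -(@ler_pXn2r _ 2) ?nnegrE ?mulr_ge0 ?enorm_ge0//.
rewrite real_normK ?num_real// exprMn !enorm_sqr !dotE.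
apply: le_trans (@sum_Cauchy_Schwarz _ _ _ _) _.
by under eq_bigr do rewrite expr2; under [X in _ * X <= _]eq_bigr do rewrite expr2.
Qed.

Lemma enorm_sqrD x y :
  enorm (x + y) ^+ 2 = enorm x ^+ 2 + (x^T *m y) 0 0 *+ 2 + enorm y ^+ 2.
Proof.
rewrite !enorm_sqr !dotE -sumrMnl -!big_split /=.
by apply: eq_bigr => i _; rewrite mxE; ring.
Qed.

Lemma enormD x y : enorm (x + y) <= enorm x + enorm y.
Proof.
rewrite -(@ler_pXn2r _ 2) ?nnegrE ?addr_ge0 ?enorm_ge0// enorm_sqrD sqrrD.
by rewrite lerD2r lerD2l lerMn2r dot_le.
Qed.

Lemma enormB x y : enorm (x - y) = enorm (y - x).
Proof. by rewrite -enormN opprB. Qed.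

Lemma enorm_triangle y x z : enorm (x - z) <= enorm (x - y) + enorm (y - z).
Proof. by rewrite (le_trans _ (enormD _ _))// addrA subrK. Qed.

Lemma coord_le_enorm x i : `|x i 0| <= enorm x.
Proof.
rewrite -(@ler_pXn2r _ 2) ?nnegrE ?enorm_ge0// real_normK ?num_real//.
rewrite enorm_sqr dotE (bigD1 i)//= expr2 lerDl.
by apply: sumr_ge0 => j _; rewrite -expr2 sqr_ge0.
Qed.

Lemma enorm_le_coord x (c : R) : 0 <= c -> (forall i, `|x i 0| <= c) ->
  enorm x <= d%:R * c.
Proof.
move=> c0 xc; rewrite -(@ler_pXn2r _ 2) ?nnegrE ?enorm_ge0 ?mulr_ge0//.
rewrite enorm_sqr dotE; apply: (@le_trans _ _ (\sum_(i < d) c ^+ 2)).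
  apply: ler_sum => i _; rewrite -expr2 -real_normK ?num_real//.
  by rewrite ler_pXn2r ?nnegrE.
rewrite sumr_const card_ord exprMn -[_ *+ d]mulr_natl ler_wpM2r ?sqr_ge0//.
by rewrite -natrX ler_nat; case: (d) => // n; rewrite expnS expn1 leq_pmulr.
Qed.

Lemma enorm_orthogonal A x : A^T *m A = 1%:M -> enorm (A *m x) = enorm x.
Proof.
move=> AA; apply/eqP; rewrite -(@eqrXn2 _ 2) ?enorm_ge0// !enorm_sqr.
by rewrite trmx_mul mulmxA -(mulmxA _ A^T) AA mulmx1.
Qed.

Lemma enorm_proj A x : A *m A = A -> A^T = A -> enorm (A *m x) <= enorm x.
Proof.
move=> AA AT; have [->|y0] := eqVneq (enorm (A *m x)) 0; first exact: enorm_ge0.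
rewrite -(@ler_pM2r _ (enorm (A *m x))); last by rewrite lt_def y0 enorm_ge0.
rewrite -expr2 enorm_sqr trmx_mul AT -mulmxA (mulmxA A) AA.
exact: dot_le.
Qed.

End Euclidean.

(** Sylvester's identity, from two factorisations of one block matrix into block triangular ones. It
    reduces the determinant of a reflection to a 1 by 1 determinant. *)
Lemma det_1Dmulmx (R : comPzRingType) (m n : nat) (A : 'M[R]_(m, n))
  (B : 'M[R]_(n, m)) : \det (1%:M + A *m B) = \det (1%:M + B *m A).
Proof.
have E1 : block_mx (1%:M : 'M[R]_m) (- A) B 1%:M =
    block_mx 1%:M 0 B 1%:M *m block_mx 1%:M (- A) 0 (1%:M + B *m A).
  by rewrite mulmx_block !mul1mx !mulmx1 !mul0mx ?mulmx0 ?addr0 mulmxN addrC addrK.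
have E2 : block_mx (1%:M : 'M[R]_m) (- A) B 1%:M =
    block_mx (1%:M + A *m B) (- A) 0 1%:M *m block_mx 1%:M 0 B 1%:M.
  by rewrite mulmx_block !mul1mx !mulmx1 !mul0mx ?mulmx0 ?add0r mulNmx addrK.
have := congr1 determinant E1; rewrite {1}E2 !det_mulmx !det_lblock !det_ublock.
by rewrite !det1 !mulr1 !mul1r.
Qed.

Section Rotations.
Context {R : realType} {d : nat}.
Implicit Types (x y a : 'cV[R]_d).

(** The Householder reflection in the hyperplane orthogonal to [a]; it is the identity when
    [a = 0]. *)
Definition reflection a : 'M[R]_d :=
  1%:M - (2 / enorm a ^+ 2) *: (a *m a^T).

Lemma tr_reflection a : (reflection a)^T = reflection a.
Proof. by rewrite linearB /= linearZ /= trmx_mul trmxK trmx1. Qed.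

Lemma mul_dot (a x y : 'cV[R]_d) : a *m (x^T *m y) = (x^T *m y) 0 0 *: a.
Proof.
by rewrite {1}[x^T *m y]mx11_scalar mul_mx_scalar.
Qed.

Lemma reflectionE a x :
  reflection a *m x = x - (2 / enorm a ^+ 2 * (a^T *m x) 0 0) *: a.
Proof. by rewrite mulmxBl mul1mx -scalemxAl -mulmxA mul_dot scalerA. Qed.

Lemma reflectionK a : a != 0 -> reflection a *m reflection a = 1%:M.
Proof.
rewrite -enorm_eq0 => a0; rewrite /reflection; set c := 2 / _.
have aa : a *m a^T *m (a *m a^T) = enorm a ^+ 2 *: (a *m a^T).
  by rewrite mulmxA -(mulmxA a) mul_dot -scalemxAl enorm_sqr.
rewrite mulmxBr mulmx1 mulmxBl mul1mx -!scalemxAl -scalemxAr aa !scalerA.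
have -> : c * c * enorm a ^+ 2 = c + c by rewrite /c; field.
by rewrite scalerDl -addrA -opprD addrA subrr oppr0 addr0.
Qed.

Lemma det_reflection a : a != 0 -> \det (reflection a) = -1.
Proof.
rewrite -enorm_eq0 => a0.
rewrite /reflection -scaleNr scalemxAl det_1Dmulmx -scalemxAr det_mx11 !mxE eqxx.
have := enorm_sqr a; rewrite mxE => <-; rewrite mulNr mulfVK ?expf_neq0// mulr1n; ring.
Qed.

Lemma rotation_mul_reflection a b : a != 0 -> b != 0 ->
  rotation d (reflection a *m reflection b).
Proof.
move=> a0 b0; split; last by rewrite det_mulmx !det_reflection// mulrNN mulr1.
rewrite trmx_mul !tr_reflection mulmxA -(mulmxA (reflection a)) reflectionK//.
by rewrite mulmx1 reflectionK.
Qed.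

(** Equal norms give |x - y|^2 = 2 <x - y, x>, so the reflection subtracts exactly [x - y] from
    [x]. *)
Lemma reflection_swap x y : enorm x = enorm y -> x != y ->
  reflection (x - y) *m x = y.
Proof.
move=> xy xNy; have xy0 : enorm (x - y) ^+ 2 != 0.
  by rewrite expf_neq0// enorm_eq0 subr_eq0.
rewrite reflectionE (_ : _ * _ = 1) ?scale1r ?subKr//.
have E : enorm (x - y) ^+ 2 = ((x - y)^T *m x) 0 0 *+ 2.
  have xy2 : \sum_i x i 0 * x i 0 = \sum_i y i 0 * y i 0.
    by rewrite -!dotE -!enorm_sqr xy.
  apply/eqP; rewrite enorm_sqr !dotE -subr_eq0 -sumrMnl -sumrB.
  rewrite (eq_bigr (fun i => y i 0 * y i 0 - x i 0 * x i 0)).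
    by rewrite sumrB xy2 subrr.
  by move=> i _; rewrite !mxE; ring.
have t0 : ((x - y)^T *m x) 0 0 != 0 by move: xy0; rewrite E mulrn_eq0.
by rewrite E -mulr_natl; field.
Qed.

(* Composing with a second reflection, in a vector orthogonal to [x], makes the
   determinant equal to 1; such a vector exists since d >= 2. *)
Lemma rotation_transitive x y : (1 < d)%N -> enorm x = enorm y ->
  exists2 g, rotation d g & g *m x = y.
Proof.
move=> d1 xy; have [<-|xNy] := eqVneq x y.
  exists 1%:M; last by rewrite mul1mx.
  by split; rewrite ?mul1mx ?trmx1// det1.
have [a a0 ax] : exists2 a : 'cV[R]_d, a != 0 & a^T *m x = 0.
  have : kermx x != 0.
    by rewrite kermx_eq0 /row_free ltn_eqF//; exact: leq_ltn_trans (rank_leq_col _) d1.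
  case/matrix0Pn => i [j aij]; exists (row i (kermx x))^T.
    by apply/matrix0Pn; exists j, 0; rewrite mxE mxE.
  by rewrite trmxK -row_mul mulmx_ker row0.
exists (reflection (x - y) *m reflection a).
  by apply: rotation_mul_reflection; rewrite ?subr_eq0.
by rewrite -mulmxA (reflectionE a) ax mxE mulr0 scale0r subr0 reflection_swap.
Qed.

End Rotations.

(** * Integer points near the kernel of a projection *)

(** Take [f] maximising the absolute value of the minor. By Cramer's rule, entry (i, j) is the minor
    with row j replaced by row i of [B], divided by the maximal one. *)
Lemma max_minor (R : realFieldType) (d k : nat) (B : 'M[R]_(d, k)) :
  row_full B -> exists f : 'I_k -> 'I_d, rowsub f B \in unitmx /\
    forall i j, `|(B *m invmx (rowsub f B)) i j| <= 1.
Proof.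
move=> fullB; pose f0 : {ffun 'I_k -> 'I_d} := finfun (fullrankfun fullB).
pose m (f : {ffun 'I_k -> 'I_d}) := `|\det (rowsub f B)|.
have m0 : 0 < m f0.
  rewrite normr_gt0 -unitfE -unitmxE (_ : rowsub _ _ = rowsub (fullrankfun fullB) B).
    exact: fullrowsub_unit.
  by apply/matrixP => i j; rewrite !mxE ffunE.
case: (@arg_maxP _ _ _ f0 xpredT m isT) => f _ fmax.
have Bf : 0 < `|\det (rowsub f B)| by apply: (lt_le_trans m0); exact: fmax.
have Bf1 : rowsub f B \in unitmx by rewrite unitmxE unitfE -normr_gt0.
exists f; split=> // i j.
pose f' : {ffun 'I_k -> 'I_d} := [ffun l => if l == j then i else f l].
have -> : (B *m invmx (rowsub f B)) i j =
    (\det (rowsub f B))^-1 * \det (rowsub f' B).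
  rewrite /invmx Bf1 -scalemxAr mxE; congr (_ * _).
  rewrite mxE (expand_det_row _ j); apply: eq_bigr => l _.
  rewrite [\adj _ _ _]mxE [rowsub _ _ _ _]mxE ffunE eqxx; congr (_ * (_ * \det _)).
  by apply/matrixP => a b; rewrite !mxE ffunE eq_sym (negPf (neq_lift _ _)).
by rewrite normrM normfV ler_pdivrMl// mulr1; exact: fmax.
Qed.

(* Writing the range of [P] as the graph of a linear map over k well chosen
   coordinates, the entries of that map can be bounded by 1 uniformly in [P]. *)
Lemma bounded_graph_basis (R : realFieldType) (d : nat) (P : 'M[R]_d) :
  P *m P = P -> exists (f : 'I_(\rank P) -> 'I_d) (M : 'M[R]_(d, \rank P)),
    [/\ P *m M = M, rowsub f M = 1%:M & forall i j, `|M i j| <= 1].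
Proof.
move=> PP; have [f [Bu Bmax]] := max_minor (col_base_full P).
exists f, (col_base P *m invmx (rowsub f (col_base P))); split=> //.
- rewrite mulmxA; congr (_ *m _).
  apply: (row_free_inj (row_base_free P)); first by rewrite -mulmxA !mulmx_base PP.
- by rewrite -mul_rowsub_mx mulmxV.
Qed.

Section GridCount.
Context {R : realType} {d : nat}.
Implicit Types (P : 'M[R]_d) (w : 'cV[R]_d).

(** Coordinates run over 1, ..., n, so that for d > 0 the vector is nonzero and can be rescaled to
    any positive length. *)
Definition grid_vec (n : nat) (u : {ffun 'I_d -> 'I_n}) : 'cV[R]_d :=
  \col_i (u i).+1%:R.

Lemma eqn_of_dist_mod (a b L : nat) : (a = b %[mod L])%N ->
  `|a%:R - b%:R : R| < L%:R -> a = b.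
Proof.
wlog ab : a b / (b <= a)%N.
  move=> H; case: (leqP b a) => [|/ltnW] ba; first exact: H.
  by move=> /esym abL; rewrite distrC => abL'; apply/esym/H.
move=> abL; rewrite -natrB// normr_nat ltr_nat => abL'.
have : (L %| a - b)%N by rewrite -eqn_mod_dvd//; apply/eqP.
rewrite /dvdn modn_small// subn_eq0 => ab'.
by apply/eqP; rewrite eqn_leq ab' ab.
Qed.

(** Such a point is determined by its coordinates outside the range of [f] and the residues mod [L]
    of the others. Indeed, if two of them agree outside the range of [f], their remaining
    coordinates differ by at most 2 d C < L. *)
Lemma card_grid_near_ker P (n L : nat) (C : R) :
  P *m P = P -> P^T = P -> 2 * d%:R * C < L%:R ->
  (#|[set u : {ffun 'I_d -> 'I_n} | (enorm (P *m grid_vec u) <= C)%R]%SET|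
    <= L ^ \rank P * n ^ (d - \rank P))%N.
Proof.
move=> PP PT CL.
have [->|/set0Pn[u0]] := eqVneq
    [set u : {ffun 'I_d -> 'I_n} | (enorm (P *m grid_vec u) <= C)%R]%SET finset.set0.
  by rewrite cards0.
rewrite inE => /(le_trans (enorm_ge0 _)) C0.
have L0 : (0 < L)%N.
  by rewrite -(ltr_nat R) (le_lt_trans _ CL)// !mulr_ge0.
have [f [M [PM Mf M1]]] := bounded_graph_basis PP.
have Mfjj j j' : M (f j') j = (j' == j)%:R.
  by have /matrixP/(_ j' j) := Mf; rewrite !mxE.
have finj : injective f.
  move=> a b fab; have /eqP := Mfjj a b; rewrite -fab Mfjj eqxx.
  by have [->|_] := eqVneq b a; rewrite ?oner_eq0.
have MP : M^T *m P = M^T by rewrite -[in RHS]PM trmx_mul PT.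
(* As [rowsub f M] is the identity and [w] vanishes off the range of [f], the coordinate [w (f j)]
   is entry j of M^T w = M^T P w, and the entries of [M] are at most 1. *)
have bound w : (forall i, i \notin codom f -> w i 0 = 0) ->
    forall j, `|w (f j) 0| <= d%:R * enorm (P *m w).
  move=> w0 j; have -> : w (f j) 0 = (M^T *m (P *m w)) j 0.
    rewrite mulmxA MP mxE (bigD1 (f j))//= mxE Mfjj eqxx mul1r.
    rewrite big1 ?addr0// => i iNfj; rewrite mxE.
    case: (boolP (i \in codom f)) => [/codomP[j' ij']|/w0->]; last by rewrite mulr0.
    rewrite ij' Mfjj; case: eqP => [jj'|_]; last by rewrite mul0r.
    by rewrite ij' jj' eqxx in iNfj.
  rewrite mxE (le_trans (ler_norm_sum _ _ _))//.
  rewrite -[d in d%:R]card_ord mulr_natl -sumr_const; apply: ler_sum => i _.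
  by rewrite normrM mxE -[leRHS]mul1r ler_pM ?coord_le_enorm.
pose h (u : {ffun 'I_d -> 'I_n}) :
  {ffun 'I_(\rank P) -> 'I_L} * {ffun {i : 'I_d | i \notin codom f} -> 'I_n} :=
  ([ffun j : 'I_(\rank P) => Ordinal (ltn_pmod (u (f j)) L0)],
   [ffun i : {i : 'I_d | i \notin codom f} => u (val i)]).
have hinj : {in [set u : {ffun 'I_d -> 'I_n} | (enorm (P *m grid_vec u) <= C)%R]%SET &,
    injective h}.
  move=> u v; rewrite !inE => uC vC [/ffunP huv1 /ffunP huv2].
  apply/ffunP => i; case: (boolP (i \in codom f)) => [|iNf]; last first.
    by have := huv2 (exist _ i iNf); rewrite !ffunE.
  case/codomP => j ->; apply/val_inj/(@eqn_of_dist_mod _ _ L) => /=.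
    by have := congr1 val (huv1 j); rewrite !ffunE.
  have -> : (u (f j))%:R - (v (f j))%:R = (grid_vec u - grid_vec v) (f j) 0.
    by rewrite !mxE -[(u _).+1]addn1 -[(v _).+1]addn1 !natrD; ring.
  apply: le_lt_trans (bound _ _ _) _.
    move=> l lNf; rewrite !mxE; have := huv2 (exist _ l lNf); rewrite !ffunE => ->.
    by rewrite subrr.
  apply: le_lt_trans CL; rewrite mulrAC [2 * C * _]mulrC ler_wpM2l// mulmxBr.
  by rewrite mulr_natl mulr2n (le_trans (enormD _ _))// enormN lerD.
apply: leq_trans (@leq_card_in _ _ h _ hinj) _.
rewrite card_prod !card_ffun !card_ord card_sig leq_mul2l; apply/orP; right.
rewrite (_ : #|_| = (d - \rank P)%N)//.
have := cardC (mem (codom f)).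
rewrite card_codom// !card_ord => /(congr1 (subn^~ (\rank P))).
by rewrite addKn => <-; apply: eq_card => i; rewrite !inE.
Qed.

End GridCount.

(** * Measurability and sums of indicators *)

Lemma continuous_sum_ord (R : realType) (T : topologicalType) (n : nat)
    (f : 'I_n -> T -> R) :
  (forall i, continuous (f i)) -> continuous (fun x => \sum_i f i x).
Proof.
move=> fc x; apply: (@cvg_big R^o _ +%R 0 xpredT) => [y|i _]; last exact: fc.
exact: add_continuous.
Qed.

Lemma closed_forall (T : topologicalType) (I : Type) (Q : I -> T -> Prop) :
  (forall i, closed [set x | Q i x]) -> closed [set x | forall i, Q i x].
Proof.
move=> cQ; rewrite (_ : [set x | _] = \bigcap_(i in setT) [set x | Q i x]).
  by apply: closed_bigI => i _; exact: cQ.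
by apply/seteqP; split=> x /= Qx i; [move=> _|]; exact: Qx.
Qed.

Lemma closed_eq_fun (R : realType) (T : topologicalType) (f g : T -> R) :
  continuous f -> continuous g -> closed [set x | f x = g x].
Proof.
move=> fc gc; rewrite (_ : [set x | _] = (fun x => f x - g x) @^-1` [set y | y = 0]).
  apply: preimage_closed; last exact: closed_eq.
  by move=> x _; apply: (@continuousB _ R^o); [exact: fc|exact: gc].
by apply/seteqP; split=> x /= => [->|/eqP]; rewrite ?subrr// subr_eq0 => /eqP.
Qed.

Section Continuity.
Context {R : realType} {d : nat}.

Lemma continuous_enorm (T : topologicalType) (f : T -> 'cV[R]_d) :
  (forall i, continuous (fun x => f x i 0)) -> continuous (fun x => enorm (f x)).
Proof.
move=> fc x; apply: (@continuous_comp _ _ _ (fun x => \sum_i f x i 0 ^+ 2) Num.sqrt).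
  apply: continuous_sum_ord => i y.
  by apply: (@continuousM _ _ (fun x => f x i 0) (fun x => f x i 0)); exact: fc.
exact: sqrt_continuous.
Qed.

Lemma open_ball_enorm (a : 'cV[R]_d) (r : R) :
  open [set x | enorm (x - a) < r].
Proof.
apply: (@open_comp _ _ (fun x : 'cV[R]_d => enorm (x - a)) [set y | y < r]).
  move=> x _; apply: continuous_enorm => i y.
  rewrite (_ : (fun x => _) = (fun x : 'cV[R]_d => x i 0 - a i 0)); last first.
    by apply/funext => z; rewrite !mxE.
  apply: (@continuousB _ R^o _ (fun x : 'cV[R]_d => x i 0)); last exact: cst_continuous.
  exact: coord_continuous.
exact: open_lt.
Qed.

Lemma continuous_mulmx_coord n (v : 'M[R]_(d, n)) i j :
  continuous (fun P : 'M[R]_d => (P *m v) i j).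
Proof.
under eq_fun do rewrite mxE.
apply: continuous_sum_ord => l x.
apply: (@continuousM _ _ (fun P : 'M[R]_d => P i l)); last exact: cst_continuous.
exact: coord_continuous.
Qed.

Definition near_ker (v : 'cV[R]_d) (r : R) : set 'M[R]_d :=
  [set P | enorm (P *m v) <= r].

Lemma closed_near_ker v r : closed (near_ker v r).
Proof.
apply: (@preimage_closed _ _ (fun P : 'M[R]_d => enorm (P *m v)) [set y | y <= r]).
  move=> x _; apply: continuous_enorm => i; exact: continuous_mulmx_coord.
exact: closed_le.
Qed.

(** A rank factorisation P = C B of an idempotent satisfies B C = 1. The trace, unlike the rank, is
    continuous, so the rank condition defining the Grassmannian becomes a closed one. *)
Lemma trace_idempotent (P : 'M[R]_d) : P *m P = P -> \tr P = (\rank P)%:R.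
Proof.
move=> PP; rewrite -[in LHS](mulmx_base P) mxtrace_mulC.
suff -> : row_base P *m col_base P = 1%:M by rewrite mxtrace1.
apply: (row_free_inj (row_base_free P)); rewrite mul1mx.
apply: (row_full_inj (col_base_full P)).
by rewrite -(mulmxA (row_base P)) mulmxA !mulmx_base PP.
Qed.

Lemma closed_grassmannian k : closed (grassmannian d k : set 'M[R]_d).
Proof.
have -> : grassmannian d k =
    [set P : 'M[R]_d | forall ij, (P *m P) ij.1 ij.2 = P ij.1 ij.2] `&`
    ([set P : 'M[R]_d | forall ij, P ij.2 ij.1 = P ij.1 ij.2] `&`
     [set P : 'M[R]_d | \tr P = k%:R]).
  apply/seteqP; split=> P /=.
    move=> [PP PT rP]; split; first by rewrite PP.
    split; last by rewrite trace_idempotent// rP.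
    by move=> ij; rewrite -{1}PT mxE.
  move=> [PP [PT tP]].
  have {}PP : P *m P = P by apply/matrixP => i j; have := PP (i, j).
  split=> //; first by apply/matrixP => i j; rewrite mxE (PT (i, j)).
  by apply/eqP; rewrite -(eqr_nat R) -trace_idempotent// tP.
apply: closedI; last apply: closedI.
- apply: closed_forall => -[i j] /=; apply: closed_eq_fun.
    under eq_fun do rewrite mxE.
    apply: continuous_sum_ord => l x.
    apply: (@continuousM _ _ (fun P : 'M[R]_d => P i l) (fun P : 'M[R]_d => P l j));
      exact: coord_continuous.
  exact: coord_continuous.
- by apply: closed_forall => ij; apply: closed_eq_fun; exact: coord_continuous.
- apply: closed_eq_fun; last exact: cst_continuous.
  by apply: continuous_sum_ord => i; exact: coord_continuous.
Qed.

Lemma measurable_closed_mx (A : set 'M[R]_d) :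
  closed A -> measurable (A : set (borel_mx R d)).
Proof.
move=> cA; rewrite -[A]setCK; apply: measurableC; apply: sub_sigma_algebra.
exact: closed_openC.
Qed.

End Continuity.

Section SumIndicators.
Context {R : realType} {disp : measure_display} {T : measurableType disp}
  (gamma : probability T R) {I : finType} (A : I -> set T).
Hypothesis mA : forall i, measurable (A i).

Lemma integral_sum_indic :
  (\int[gamma]_x (\sum_i \1_(A i) x : R)%:E = \sum_i gamma (A i))%E.
Proof.
under eq_integral do rewrite -sumEFin.
rewrite ge0_integral_sum//.
- by apply: eq_bigr => i _; rewrite integral_indic// setIT.
- by move=> i; apply/measurable_EFinP; exact: measurable_indic.
Qed.

Let measurable_sum_indic : measurable_fun [set: T] (fun x => \sum_i \1_(A i) x : R).
Proof. by apply: measurable_sum => i; exact: measurable_indic. Qed.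

(** Integrating the number of events that occur turns a count valid for each point of a set of full
    measure into a bound on probabilities. *)
Lemma sum_probability_le (G : set T) (c : R) :
  0 <= c -> measurable G -> gamma G = 1%E ->
  (forall x, G x -> \sum_i \1_(A i) x <= c) ->
  (\sum_i gamma (A i) <= c%:E)%E.
Proof.
move=> c0 mG G1 Gc; rewrite -integral_sum_indic.
apply: (@le_trans _ _ (\int[gamma]_x (cst c%:E x))%E); last first.
  by rewrite integral_cst//= probability_setT mule1.
apply: ae_ge0_le_integral => //.
- by move=> x _; rewrite lee_fin sumr_ge0.
- exact/measurable_EFinP.
- exists (~` G); split; first exact: measurableC.
    by rewrite /= probability_setC// G1 subee.
  by move=> x; apply: contra_not => Gx _; rewrite lee_fin Gc.
Qed.

Lemma measurable_ge_sum_indic (c : R) :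
  measurable [set x | c <= \sum_i \1_(A i) x].
Proof.
rewrite (_ : [set x | _] = [set: T] `&` (fun x => \sum_i \1_(A i) x) @^-1` `[c, +oo[).
  exact: measurable_sum_indic.
by apply/seteqP; split=> x /=; rewrite in_itv/= andbT// => -[].
Qed.

Lemma markov_sum_indic (c : R) : 0 <= c ->
  (c%:E * gamma [set x | (c <= \sum_i \1_(A i) x)%R]
    <= \sum_i gamma (A i))%E.
Proof.
move=> c0; have mB := measurable_ge_sum_indic c; set B := [set x | _] in mB *.
rewrite -integral_sum_indic.
have <- : (\int[gamma]_(x in B) cst c%:E x = c%:E * gamma B)%E by rewrite integral_cst.
apply: (@le_trans _ _ (\int[gamma]_(x in B) (\sum_i \1_(A i) x : R)%:E)%E).
  apply: ge0_le_integral => //.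
  by apply/measurable_EFinP; exact: measurable_funTS.
apply: ge0_subset_integral => //.
- exact/measurable_EFinP.
- by move=> x _; rewrite lee_fin sumr_ge0.
Qed.

End SumIndicators.

(** * The small ball estimate *)

Section SmallBall.
Context {R : realType} {d k : nat} (gamma : probability (borel_mx R d) R).
Hypothesis gammaP : grassmannian_measure d k gamma.

Lemma measurable_near_ker v r : measurable (near_ker v r : set (borel_mx R d)).
Proof. by apply: measurable_closed_mx; exact: closed_near_ker. Qed.

Lemma measurable_grassmannian :
  measurable (grassmannian d k : set (borel_mx R d)).
Proof. by apply: measurable_closed_mx; exact: closed_grassmannian. Qed.

(** Conjugation by [g] maps [near_ker v r] onto [near_ker (g *m v) r], because g P g^T (g v) = g (P
    v) has the norm of P v. *)
Lemma near_ker_rotation (g : 'M[R]_d) v r : rotation d g ->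
  gamma (near_ker (g *m v) r) = gamma (near_ker v r).
Proof.
move=> gr; have [gg _] := gr; have gg' := mulmx1C gg.
rewrite -(gammaP.2 g gr _ (measurable_near_ker v r)); congr (gamma _).
apply/seteqP; split=> [Q Qgv|_ [P Pv <-]].
  exists (g^T *m Q *m g).
    rewrite /near_ker /= -!mulmxA (@enorm_orthogonal _ _ g^T) ?trmxK//.
  by rewrite !mulmxA gg mul1mx -mulmxA gg mulmx1.
rewrite /near_ker /= -mulmxA (mulmxA g^T) gg' mul1mx -mulmxA.
by rewrite enorm_orthogonal.
Qed.

Lemma near_ker_enorm v w r : (1 < d)%N -> enorm v = enorm w ->
  gamma (near_ker v r) = gamma (near_ker w r).
Proof.
by move=> d1 /(rotation_transitive d1)[g gr <-]; rewrite near_ker_rotation.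
Qed.

(* Averaging over the rotates of [v] in the directions of the integer points
   of a box of side about |v| / r: at most a fraction (r / |v|)^k of these
   points is close to the kernel of a given projection of rank k. *)
Lemma small_ball : (1 <= k < d)%N -> exists2 K : R, 0 < K &
  forall v r, v != 0 -> 0 < r ->
    (gamma (near_ker v r) <= (K * (r / enorm v) ^+ k)%:E)%E.
Proof.
move=> /andP[k1 kd]; have d1 : (1 < d)%N by rewrite (leq_ltn_trans k1).
have d0 : (0 < d)%N by apply: ltn_trans d1.
(* Just above 2 d C for C = 2 d, the distance to the kernel used in the count below. *)
pose L := (4 * d ^ 2).+1; exists (L%:R ^+ k); first by rewrite exprn_gt0.
move=> v r v0 r0; have nv0 : 0 < enorm v by rewrite lt_def enorm_eq0 v0 enorm_ge0.
set t := r / enorm v; have t0 : 0 < t by rewrite divr_gt0.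
have [t1|t1] := leP 1 t.
  apply: (le_trans (probability_le1 _ (measurable_near_ker v r))).
  by rewrite lee_fin -exprMn exprn_ege1// mulr_ege1// ler1n.
(* The side of the box satisfies 1 / t < n <= 2 / t. *)
pose n := (Num.truncn t^-1).+1.
have tn : t^-1 < n%:R by rewrite /n -truncn_lt_nat// invr_ge0 ltW.
have nt : t * n%:R <= 2.
  have : n%:R <= t^-1 + 1.
    rewrite /n -natr1 lerD2r; have t'0 : 0 <= t^-1 by rewrite invr_ge0 ltW.
    by case/andP: (truncn_itv t'0).
  move=> /(ler_wpM2l (ltW t0)) /le_trans -> //.
  by rewrite mulrDr mulr1 mulfV ?gt_eqF//; lra.
pose G (u : {ffun 'I_d -> 'I_n}) : 'cV[R]_d := grid_vec u.
have G0 u : 0 < enorm (G u).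
  rewrite lt_def enorm_ge0 enorm_eq0 andbT; apply/eqP => /matrixP/(_ (Ordinal d0) 0).
  by rewrite !mxE => /eqP; rewrite pnatr_eq0.
have Gn u : enorm (G u) <= d%:R * n%:R.
  by apply: enorm_le_coord => // i; rewrite mxE normr_nat ler_nat ltn_ord.
pose V u := (enorm v / enorm (G u)) *: G u.
have VE u : enorm (V u) = enorm v.
  by rewrite enormZ ger0_norm ?divr_ge0 ?enorm_ge0// divfK// gt_eqF.
(* All [V u] have the norm of [v], so the n^d events have the same probability p, and p n^d <= L^k
   n^(d-k) will follow. *)
have := @sum_probability_le _ _ _ gamma _ (fun u => near_ker (V u) r)
  (fun u => measurable_near_ker _ _) _ (L ^ k * n ^ (d - k))%:R (ler0n _ _)
  measurable_grassmannian gammaP.1.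
under eq_bigr do rewrite (near_ker_enorm _ d1 (VE _)).
have gfin : gamma (near_ker v r) \is a fin_num.
  exact: fin_num_measure (measurable_near_ker v r).
rewrite -(fineK gfin) sumEFin sumr_const card_ffun !card_ord !lee_fin.
set p := fine _ => H.
suff pn : p *+ n ^ d <= (L ^ k * n ^ (d - k))%:R.
  have nk0 : 0 < (n%:R : R) ^+ k by rewrite exprn_gt0.
  have {}pn : p * n%:R ^+ k <= L%:R ^+ k.
    rewrite -(@ler_pM2r _ (n%:R ^+ (d - k))) ?exprn_gt0//.
    by rewrite -mulrA -exprD subnKC ?(ltnW kd)// -!natrX mulr_natr -natrM.
  apply: (@le_trans _ _ (L%:R ^+ k * (n%:R ^- k))); first by rewrite ler_pdivlMr.
  rewrite ler_wpM2l ?exprn_ge0// -exprVn lerXn2r ?nnegrE ?invr_ge0 ?(ltW t0)//.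
  by rewrite invf_ple ?posrE// ltW.
apply: H => P [PP PT rP].
apply: (@le_trans _ _ (#|[set u : {ffun 'I_d -> 'I_n} |
    (enorm (P *m G u) <= 2 * d%:R)%R]%SET|%:R)); last first.
  rewrite ler_nat -rP; apply: card_grid_near_ker => //.
  by rewrite -!natrM ltr_nat /L; lia.
rewrite -sum1_card natr_sum [leRHS]big_mkcond /=; apply: ler_sum => u _.
rewrite indicE inE; have [PV|_] := boolP (P \in near_ker (V u) r); last by case: ifP.
rewrite ifT//; move: PV; rewrite inE /near_ker /= /V -scalemxAr enormZ.
rewrite ger0_norm ?divr_ge0 ?enorm_ge0// mulrAC ler_pdivrMr// => PG.
(* Smallness of the image of [V u] gives |P G u| <= t |G u| <= t d n <= 2 d. *)
apply: (@le_trans _ _ (t * (d%:R * n%:R))); last first.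
  by rewrite mulrCA mulrC ler_wpM2r.
apply: (@le_trans _ _ (t * enorm (G u))); last by rewrite ler_wpM2l// ltW.
by rewrite /t mulrAC ler_pdivlMr// mulrC.
Qed.

End SmallBall.

(** * Separated sets and the Frostman condition *)

Section Separated.
Context {R : realType} {d : nat}.
Implicit Types (E F : set 'cV[R]_d).

(** Greedy choice: if m <= X points could not be extended, the open balls of radius r / 2 about them
    would cover [E] by m sets of diameter at most r. *)
Lemma separated_of_covering_number E (r X : R) : 0 < r -> 0 <= X ->
  (X%:E < covering_number r E)%E ->
  exists (m : nat) (a : 'I_m -> 'cV[R]_d), [/\ X < m%:R,
    forall i, E (a i) & forall i j, i != j -> r / 2 <= enorm (a i - a j)].
Proof.
move=> r0 X0 XE.
suff sep m : m.-1%:R <= X -> exists a : 'I_m -> 'cV[R]_d,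
    (forall i, E (a i)) /\ forall i j, i != j -> r / 2 <= enorm (a i - a j).
  have /andP[tX Xt] := truncn_itv X0.
  by have [a [Ea asep]] := sep (Num.truncn X).+1 tX; exists (Num.truncn X).+1, a.
elim: m => [_|m IHm /= mX].
  by exists (fun=> 0); split=> [[]|[]].
have [|a [Ea asep]] := IHm.
  by apply: le_trans mX; rewrite ler_nat leq_pred.
have [x Ex xa] : exists2 x, E x & forall i, r / 2 <= enorm (x - a i).
  apply: contrapT => nx.
  have : (covering_number r E <= m%:R%:E)%E.
    apply: ereal_inf_lbound; exists m => //.
    exists (fun i => [set x | enorm (x - a i) < r / 2]); split=> [i|x Ex].
      split; first exact: open_ball_enorm.
      move=> x y /= xi yi; apply: le_trans (enorm_triangle (a i) _ _) _.
      by rewrite (enormB (a i)); lra.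
    apply: contrapT => nU; apply: nx; exists x => // i; rewrite leNgt.
    by apply/negP => xi; apply: nU; exists i.
  by move=> /(lt_le_trans XE); rewrite lte_fin ltNge mX.
exists (fun i => if unlift ord0 i is Some j then a j else x); split=> [i|i j].
  by case: unliftP.
case: unliftP => [i' ->|->]; case: unliftP => [j' ->|->] //.
- by rewrite (inj_eq lift_inj); exact: asep.
- by rewrite enormB.
Qed.

(** Round coordinates to a mesh [e] with d e < r / 2, so that distinct points get distinct cells; an
    interval of length 2 M r meets at most 4 M (d + 1) + 1 cells. *)
Lemma packing (M m : nat) (a : 'I_m -> 'cV[R]_d) (c : 'cV[R]_d) (r : R)
    (B : {set 'I_m}) : 0 < r ->
  (forall i j, i != j -> r / 2 <= enorm (a i - a j)) ->
  (forall i, i \in B -> enorm (a i - c) <= M%:R * r) ->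
  (#|B| <= (4 * M * d.+1).+1 ^ d)%N.
Proof.
move=> r0 asep aB; pose e : R := r / (2 * d.+1%:R).
have e0 : 0 < e by rewrite divr_gt0// mulr_gt0.
pose x i j := ((a i - c) j 0 + M%:R * r) / e.
have x0 i j : i \in B -> 0 <= x i j.
  move=> /aB ai; rewrite divr_ge0 ?(ltW e0)//.
  have := le_trans (coord_le_enorm (a i - c) j) ai.
  by rewrite ler_norml => /andP[+ _]; lra.
have xM i j : i \in B -> (Num.truncn (x i j) < (4 * M * d.+1).+1)%N.
  move=> iB; rewrite ltnS -(ler_nat R).
  have /andP[/le_trans -> //] := truncn_itv (x0 i j iB).
  rewrite ler_pdivrMr//; have := le_trans (coord_le_enorm (a i - c) j) (aB i iB).
  rewrite ler_norml => /andP[_ ai].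
  have -> : (4 * M * d.+1)%:R * e = 2 * (M%:R * r).
    have D0 : d.+1%:R != 0 :> R by rewrite pnatr_eq0.
    by rewrite /e !natrM; move: (d.+1%:R) D0 => D D0; field.
  lra.
pose h i : {ffun 'I_d -> 'I_(4 * M * d.+1).+1} := [ffun j => inord (Num.truncn (x i j))].
have hinj : {in B &, injective h}.
  move=> i j iB jB /ffunP hij; apply/eqP; apply/negP => /negP/asep.
  apply/negP; rewrite -ltNge; apply: (@le_lt_trans _ _ (d%:R * e)).
    apply: enorm_le_coord; first exact: ltW.
    move=> l; have := hij l; rewrite !ffunE => /(congr1 val).
    rewrite /= !inordK ?xM// => tij.
    have /andP[i1 i2] := truncn_itv (x0 i l iB).
    have /andP[j1 j2] := truncn_itv (x0 j l jB).
    have : `|x i l - x j l| <= 1.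
      move: i1 i2 j1 j2; rewrite tij -natr1 ler_norml; lra.
    rewrite -mulrBl normrM normfV (gtr0_norm e0) ler_pdivrMr// mul1r.
    rewrite !mxE; congr (`|_| <= _); ring.
  rewrite /e mulrA ltr_pdivrMr ?mulr_gt0// -[d.+1]addn1 natrD; nra.
apply: leq_trans (@leq_card_in _ _ h _ hinj) _.
by rewrite card_ffun !card_ord.
Qed.

Definition ball_count (m : nat) (a : 'I_m -> 'cV[R]_d) (r : R) i h : nat :=
  #|[set j | (enorm (a j - a i) <= 2 ^+ h * r)%R]%SET|.

Lemma powR2_expn (s : R) (n : nat) : (2 `^ s) ^+ n = (2 ^+ n) `^ s.
Proof. by rewrite -powR_mulrn ?powR_ge0// -powRrM mulrC powRrM powR_mulrn. Qed.

(* The pair (centre, scale) maximising the s-dimensional density of a finite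
   separated set with many points gives a ball in which the normalised counting
   measure satisfies the Frostman condition with constant 1; since the
   density is huge, the ball is much larger than the separation. *)
Lemma frostman_configuration F (s : R) (l0 : nat) : 0 <= s ->
  (s%:E < assouad_dim F)%E ->
  exists (r : R) (m : nat) (a : 'I_m -> 'cV[R]_d) (L l : nat) (i0 : 'I_m),
    [/\ 0 < r /\ (l0 <= l)%N, forall i, F (a i),
      forall i j, enorm (a i - a j) <= 2 ^+ L * r &
      forall i h, (h <= L)%N -> (ball_count a r i h)%:R * (2 `^ s) ^+ l <=
        (ball_count a r i0 l)%:R * (2 `^ s) ^+ h].
Proof.
move=> s0 sF; pose K : R := ((4 * 2 ^ l0 * d.+1).+1 ^ d)%:R.
have p4 : 0 < (4 : R) `^ s by rewrite powR_gt0.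
(* This constant fails for the exponent [s] at some ball. The factor K + 1 beats the packing bound
   for radius 2^l0 r, and 4^s absorbs the rounding of scales to powers of 2. *)
pose C := (K + 1) * 4 `^ s.
have K0 : 0 <= K by rewrite ler0n.
have C0 : 0 < C by rewrite mulr_gt0// ltr_wpDl.
have [rho [r [x [/andP[r0 rrho] Fx cov]]]] : exists rho r x,
    [/\ 0 < r < rho, F x &
     ((C * (rho / r) `^ s)%:E < covering_number r (eball x rho `&` F))%E].
  apply: contrapT => nex; move: sF; rewrite ltNge => /negP; apply.
  apply: ereal_inf_lbound; exists s => //; split=> //; exists C => // rho r rrho x Fx.
  by rewrite leNgt; apply/negP => cov; apply: nex; exists rho, r, x.
have X0 : 0 <= C * (rho / r) `^ s by rewrite mulr_ge0 ?powR_ge0// ltW.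
have [m [a [mX Ea asep]]] := separated_of_covering_number r0 X0 cov.
(* The least such exponent L makes every ball of radius 2^L r about a chosen point contain all of
   them, while 2^L <= 4 rho / r. *)
have exL : exists n, 2 * rho <= 2 ^+ n * r.
  exists (Num.truncn (2 * rho / r)).+1.
  rewrite -ler_pdivrMr//; apply: le_trans (ltW (truncnS_gt _)) _.
  by rewrite -natrX ler_nat ltnW// ltn_expl.
case: (ex_minnP exL) => L L1 L2.
have L4 : 2 ^+ L <= 4 * (rho / r).
  case: L L1 L2 => [L1 _|L _ L2].
    by move: L1; rewrite expr0 mul1r; lra.
  have : ~~ (2 * rho <= 2 ^+ L * r) by apply/negP => /L2; rewrite ltnn.
  rewrite -ltNge exprS mulrA ler_pdivlMr//; lra.
have diam i j : enorm (a i - a j) <= 2 ^+ L * r.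
  apply: le_trans L1; apply: le_trans (enorm_triangle x _ _) _.
  have [xi _] := Ea i; have [xj _] := Ea j.
  by rewrite (enormB x); move: xi xj; rewrite /eball /=; lra.
have m0 : (0 < m)%N by rewrite -(ltr_nat R) (le_lt_trans X0).
pose w : R := 2 `^ s; have w1 : 1 <= w by rewrite -(powRr0 2) ler_powR// ler1n.
have w0 : 0 < w by apply: lt_le_trans w1.
pose dens (ih : 'I_m * 'I_L.+1) : R := (ball_count a r ih.1 ih.2)%:R / w ^+ ih.2.
case: (@arg_maxP _ _ _ (Ordinal m0, ord0) xpredT dens isT) => -[i0 l] _ dmax.
have frost i h : (h <= L)%N -> (ball_count a r i h)%:R * w ^+ l <=
    (ball_count a r i0 l)%:R * w ^+ h.
  rewrite -ltnS => hL; have := dmax (i, Ordinal hL) isT; rewrite /dens /= => dm.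
  rewrite -ler_pdivrMr ?exprn_gt0// mulrAC -ler_pdivlMr ?exprn_gt0//.
exists r, m, a, L, l, i0; split=> //; last by move=> i; case: (Ea i).
(* If l < l0, the densest ball has at most K points, and comparison with scale L gives m <= K 2^(Ls)
   <= K (4 rho / r)^s < m. *)
split=> //; rewrite leqNgt; apply/negP => ll0.
have cnt0 : (ball_count a r i0 l)%:R <= K.
  rewrite ler_nat; apply: (packing (c := a i0) r0 asep) => i.
  rewrite inE => /le_trans -> //.
  by rewrite ler_wpM2r ?(ltW r0)// natrX ler_weXn2l ?ler1n// ltnW.
have := frost i0 L (leqnn _).
have -> : ball_count a r i0 L = m.
  rewrite -[RHS](card_ord m) -cardsT; congr #|pred_of_set _|.
  by apply/setP => j; rewrite !inE diam.
apply/negP; rewrite -ltNge.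
apply: (@le_lt_trans _ _ (K * (4 `^ s * (rho / r) `^ s))).
  apply: ler_pM; rewrite ?ler0n ?exprn_ge0// ?(ltW w0)//.
  have rr0 : 0 <= rho / r by rewrite divr_ge0 ?ltW// (lt_trans r0).
  rewrite -powRM// /w powR2_expn; apply: ge0_ler_powR => //.
    by rewrite nnegrE exprn_ge0.
  by rewrite nnegrE mulr_ge0.
apply: (@lt_le_trans _ _ m%:R).
  apply: le_lt_trans mX; rewrite mulrA ler_wpM2r ?powR_ge0//.
  by rewrite ler_wpM2r ?lerDl// ltW.
by rewrite ler_peMr// exprn_ege1.
Qed.

End Separated.

(** * Projections of Frostman sets *)

(** Cauchy-Schwarz for the fibre sizes of [c], whose squares add up to the number of colliding
    pairs. *)
Lemma card_sqr_le_collisions (R : realDomainType) (T : finType) (q : nat)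
    (c : T -> 'I_q) :
  (#|T|%:R : R) ^+ 2 <= q%:R * \sum_i \sum_j (c i == c j)%:R.
Proof.
pose f x : R := \sum_i (c i == x)%:R.
have -> : #|T|%:R = \sum_x f x * 1.
  under eq_bigr do rewrite mulr1.
  rewrite exchange_big /= (eq_bigr (fun=> 1)); first by rewrite sumr_const.
  move=> i _; rewrite (bigD1 (c i))//= eqxx big1 ?addr0// => x.
  by rewrite eq_sym => /negPf ->.
have -> : \sum_i \sum_j ((c i == c j)%:R : R) = \sum_x f x ^+ 2.
  under [RHS]eq_bigr do rewrite expr2 mulr_suml.
  rewrite [RHS]exchange_big; apply: eq_bigr => i _ /=.
  rewrite (bigD1 (c i))//= [X in _ + X]big1 ?addr0; last first.
    by move=> x; rewrite eq_sym => /negPf ->; rewrite mul0r.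
  by rewrite eqxx mul1r; apply: eq_bigr => j _; rewrite eq_sym.
apply: le_trans (sum_Cauchy_Schwarz _ _) _.
by rewrite mulrC; under eq_bigr do rewrite expr1n; rewrite sumr_const card_ord.
Qed.

Lemma geometric_sum_le (R : realFieldType) (q : R) (n : nat) : 0 <= q < 1 ->
  \sum_(h < n) q ^+ h <= (1 - q)^-1.
Proof.
move=> /andP[q0 q1]; have q1' : 0 < 1 - q by rewrite subr_gt0.
rewrite -[leRHS]mul1r ler_pdivlMr// mulrC -opprB mulNr -subrX1 opprB.
by rewrite gerBl exprn_ge0.
Qed.

Lemma powR2_lt (R : realType) (x y : R) : x < y -> 2 `^ x < 2 `^ y.
Proof.
move=> xy; rewrite /powR (negPf (_ : 2 != 0)) ?pnatr_eq0// ltr_expR.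
by rewrite ltr_pM2r// ln_gt0// ltr1n.
Qed.

Section GoodProjections.
Context {R : realType} {d k : nat} (gamma : probability (borel_mx R d) R).
Hypothesis gammaP : grassmannian_measure d k gamma.
Hypothesis kd : (1 <= k < d)%N.

(** Dyadic decomposition in the distance from [a i]: at scale 2^h r there are at most N 2^((h-l)s)
    points, each contributing O(2^(-hk)), and s < k makes the sum over h geometric. *)
Lemma energy_bound (s : R) : 0 <= s < k%:R -> exists2 K : R, 0 < K &
  forall (r : R) (m : nat) (a : 'I_m -> 'cV[R]_d) (L l : nat) (N : R),
    0 < r -> (forall i j, enorm (a i - a j) <= 2 ^+ L * r) ->
    (forall i h, (h <= L)%N ->
      (ball_count a r i h)%:R * (2 `^ s) ^+ l <= N * (2 `^ s) ^+ h) ->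
    forall i, (\sum_j gamma (near_ker (a i - a j) r)
      <= (K * (N / (2 `^ s) ^+ l))%:E)%E.
Proof.
move=> /andP[s0 sk]; have [K K0 ball] := small_ball gammaP kd.
pose w : R := 2 `^ s; have w0 : 0 < w by rewrite powR_gt0.
pose q : R := 2^-1 ^+ k; have q0 : 0 < q by rewrite exprn_gt0.
have qw : 0 <= q * w < 1.
  rewrite mulr_ge0 ?ltW//= /q exprVn mulrC ltr_pdivrMr ?exprn_gt0// mul1r.
  by rewrite -powR_mulrn// /w powR2_lt.
(* The summand 1 serves h = 0, and 2^k the loss from |a i - a j| > 2^(h-1) r for the least h. *)
pose K2 := 1 + K * 2 ^+ k.
have K20 : 0 < K2 by rewrite addr_gt0// mulr_gt0// exprn_gt0.
exists (K2 / (1 - q * w)).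
  by rewrite divr_gt0// subr_gt0; case/andP: qw.
move=> r m a L l N r0 diam frost i.
have pair j : (gamma (near_ker (a i - a j) r) <=
    (K2 * \sum_(h < L.+1) q ^+ h * (enorm (a j - a i) <= 2 ^+ h * r)%R%:R)%:E)%E.
  have exh : exists h, enorm (a j - a i) <= 2 ^+ h * r by exists L.
  case: (ex_minnP exh) => h h1 h2; have hL : (h < L.+1)%N by rewrite ltnS h2.
  apply: (@le_trans _ _ (K2 * q ^+ h)%:E); last first.
    rewrite lee_fin ler_wpM2l ?(ltW K20)// (bigD1 (Ordinal hL))//= h1 mulr1 lerDl.
    by apply: sumr_ge0 => h' _; rewrite mulr_ge0 ?ler0n// exprn_ge0// ltW.
  case: h h1 h2 hL => [|h] h1 h2 _.
    apply: (le_trans (probability_le1 _ (measurable_near_ker _ _))).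
    by rewrite lee_fin expr0 mulr1 lerDl mulr_ge0 ?ltW// exprn_gt0.
  have hr : 2 ^+ h * r < enorm (a i - a j).
    by rewrite enormB ltNge; apply/negP => /h2; rewrite ltnn.
  have hr0 : 0 < 2 ^+ h * r by rewrite mulr_gt0// exprn_gt0.
  have aij0 : 0 < enorm (a i - a j) by apply: lt_trans hr.
  apply: le_trans (ball (a i - a j) r _ r0) _.
    by rewrite -enorm_eq0 gt_eqF.
  rewrite lee_fin; apply: (@le_trans _ _ (K * 2 ^+ k * q ^+ h.+1)); last first.
    by rewrite ler_wpM2r ?exprn_ge0 ?(ltW q0)// lerDr.
  rewrite -mulrA ler_wpM2l ?(ltW K0)//.
  have -> : 2 ^+ k * q ^+ h.+1 = (2^-1 ^+ h) ^+ k :> R.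
    by rewrite /q [in LHS]exprAC -exprMn exprS mulrA mulfV ?mul1r.
  rewrite lerXn2r ?nnegrE ?exprn_ge0 ?divr_ge0 ?(ltW r0) ?enorm_ge0//.
  by rewrite ler_pdivrMr// exprVn ler_pdivlMl ?exprn_gt0// ltW.
apply: (@le_trans _ _ (\sum_j (K2 * \sum_(h < L.+1) q ^+ h *
    (enorm (a j - a i) <= 2 ^+ h * r)%R%:R)%:E)%E).
  by apply: lee_sum => j _; exact: pair.
rewrite sumEFin lee_fin -mulr_sumr -mulrA ler_wpM2l ?(ltW K20)//.
rewrite exchange_big /= mulrC.
apply: (@le_trans _ _ (\sum_(h < L.+1) (N / w ^+ l) * (q * w) ^+ h)).
  apply: ler_sum => h _; rewrite -mulr_sumr exprMn mulrCA.
  rewrite ler_wpM2l ?exprn_ge0 ?(ltW q0)// mulrAC ler_pdivlMr ?exprn_gt0//.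
  apply: le_trans (frost i h _); last by rewrite -ltnS.
  rewrite ler_wpM2r ?exprn_ge0 ?(ltW w0)// /ball_count -sum1_card natr_sum.
  by rewrite [leRHS]big_mkcond; apply: ler_sum => j _; rewrite inE; case: ifP.
rewrite -mulr_sumr ler_wpM2l ?geometric_sum_le//.
rewrite divr_ge0 ?exprn_ge0 ?(ltW w0)//.
(* The Frostman condition at h = 0 yields N >= 0. *)
have := frost i 0%N isT; rewrite expr0 mulr1; apply: le_trans.
by rewrite mulr_ge0 ?exprn_ge0 ?(ltW w0).
Qed.

(** [E] consists of the P that bring at least n^2 / 2^(lt) pairs of the n points of a Frostman ball
    within r of each other. The constant [K] is uniform in [l0]. *)
Lemma good_projections F (s t : R) : 0 <= t < s -> s < k%:R ->
  (s%:E < assouad_dim F)%E ->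
  exists2 K : R, 0 < K & forall l0 : nat, exists E : set (borel_mx R d),
    [/\ measurable E,
      (gamma E <= (K * (2 `^ t / 2 `^ s) ^+ l0)%:E)%E &
      forall P, grassmannian d k P -> ~ E P ->
        exists (l : nat) (y : 'cV[R]_d) (r : R), [/\ (l0 <= l)%N, 0 < r,
          proj_image P F y &
          (((2 `^ t) ^+ l)%:E <=
            covering_number r (eball y (2 ^+ l * r) `&` proj_image P F))%E]].
Proof.
move=> /andP[t0 ts] sk sF; have s0 : 0 <= s by rewrite (le_trans t0)// ltW.
have [|K K0 energy] := @energy_bound s; first by rewrite s0.
exists K => // l0.
have [r [m [a [L [l [i0 [[r0 ll0] Fa diam frost]]]]]]] :=
  frostman_configuration l0 s0 sF.
pose v : R := 2 `^ t; pose w : R := 2 `^ s.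
have v0 : 0 < v by rewrite powR_gt0.
have w0 : 0 < w by rewrite powR_gt0.
pose B := [set j | (enorm (a j - a i0) <= 2 ^+ l * r)%R]%SET.
pose T := {j : 'I_m | j \in B}.
have cardT : #|{: T}| = ball_count a r i0 l by rewrite card_sig.
have n0 : (0 < #|{: T}|)%N.
  by rewrite cardT card_gt0; apply/set0Pn; exists i0;
    rewrite inE subrr enorm0 mulr_ge0 ?exprn_ge0 ?ltW.
set n := #|{: T}| in cardT n0.
pose A (ij : T * T) : set (borel_mx R d) :=
  near_ker (a (val ij.1) - a (val ij.2)) r.
have mA ij : measurable (A ij) by exact: measurable_near_ker.
pose c : R := n%:R ^+ 2 / v ^+ l.
have c0 : 0 < c by rewrite divr_gt0 ?exprn_gt0// ltr0n.
pose E := [set P | c <= \sum_ij \1_(A ij) P].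
have mE : measurable E by exact: measurable_ge_sum_indic.
have sumA : (\sum_ij gamma (A ij) <= (n%:R * (K * (n%:R / w ^+ l)))%:E)%E.
  rewrite -(pair_big xpredT xpredT (fun i j => gamma (A (i, j))))/=.
  apply: (@le_trans _ _ (\sum_(i : T) (K * (n%:R / w ^+ l))%:E)%E); last first.
    by rewrite sumEFin sumr_const lee_fin -[leLHS]mulr_natl.
  apply: lee_sum => i _.
  apply: le_trans (energy r m a L l n%:R r0 diam _ (val i)); last first.
    by move=> j h hL; rewrite cardT; exact: frost.
  rewrite /A /= -(big_sub B (fun j => gamma (near_ker (a (val i) - a j) r))).
  rewrite big_mkcond; apply: lee_sum => j _.
  by case: ifP => // _; exact: measure_ge0.
exists E; split=> //.
  have := le_trans (markov_sum_indic gamma mA (ltW c0)) sumA; rewrite -/E.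
  have Efin : gamma E \is a fin_num by exact: fin_num_measure.
  rewrite -(fineK Efin) -EFinM !lee_fin => cE.
  have ml : (v / w) ^+ l <= (v / w) ^+ l0.
    rewrite ler_wiXn2l ?divr_ge0 ?(ltW v0) ?(ltW w0)//.
    by rewrite ler_pdivrMr// mul1r ltW// powR2_lt.
  apply: le_trans (ler_wpM2l (ltW K0) ml).
  rewrite -(ler_pM2l c0); apply: (le_trans cE).
  rewrite /c expr_div_n le_eqVlt; apply/orP; left; apply/eqP.
  have vl0 : v ^+ l != 0 by rewrite expf_neq0// gt_eqF.
  have wl0 : w ^+ l != 0 by rewrite expf_neq0// gt_eqF.
  by field; rewrite vl0 wl0.
move=> P [PP PT rP] EP; exists l, (P *m a i0), r; split=> //; first by exists (a i0).
have {}EP : \sum_ij \1_(A ij) P < c by rewrite ltNge; apply/negP.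
apply: le_ereal_inf_tmp => _ [q [U [Uopen cover]] <-]; rewrite lee_fin.
(* An orthogonal projection does not increase distances, so the images of the n points stay in the
   ball about the image of its centre and are covered. *)
have PaT (i : T) : exists x, U x (P *m a (val i)).
  have [|x _ Ux] := cover (P *m a (val i)); last by exists x.
  split; last by exists (a (val i)).
  rewrite /eball /= -mulmxBr (le_trans (enorm_proj _ PP PT))//.
  by have := valP i; rewrite inE.
have [f fU] := choice PaT.
(* Images in a common set of the cover are at most r apart, so collisions of [f] are close pairs. *)
have coll : \sum_i \sum_j ((f i == f j)%:R : R) <= \sum_ij \1_(A ij) P.
  rewrite pair_big; apply: ler_sum => -[i j] _ /=.
  case: eqP => [fij|_]; last by rewrite indicE ler0n.
  rewrite indicE mem_set// /A /near_ker /= mulmxBr.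
  by apply: (Uopen (f i)).2 => //; rewrite fij.
have := card_sqr_le_collisions R f; rewrite -/n => nq.
have q0 : (0 : R) <= q%:R by [].
have nn : 0 < (n%:R : R) ^+ 2 by rewrite exprn_gt0// ltr0n.
have := le_trans nq (ler_wpM2l q0 (le_trans coll (ltW EP))).
by rewrite /c mulrCA -[leLHS]mulr1 ler_pM2l// ler_pdivlMr ?exprn_gt0// mul1r.
Qed.

End GoodProjections.

(** * Almost every projection *)

Lemma geometric_lt (R : realType) (C z e : R) : 0 <= z < 1 -> 0 < e ->
  exists j, C * z ^+ j < e.
Proof.
move=> /andP[z0 z1] e0.
have : `|z| < 1 by rewrite ger0_norm.
move=> /(cvg_geometric C) /cvgrPdist_lt /(_ _ e0) [j _ jP]; exists j.
have := jP j (leqnn j); rewrite sub0r normrN; apply: le_lt_trans.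
exact: ler_norm.
Qed.

Section AssouadDimension.
Context {R : realType} {d : nat}.
Implicit Types F : set 'cV[R]_d.

Lemma assouad_dim_ge0 F : (0 <= assouad_dim F)%E.
Proof. by apply: le_ereal_inf_tmp => _ [s [s0 _] <-]; rewrite lee_fin. Qed.

(** An admissible exponent u < t with constant C would give 2^(lt) <= C 2^(lu) for arbitrarily large
    l. *)
Lemma assouad_dim_ge F (t : R) :
  (forall j : nat, exists (l : nat) (y : 'cV[R]_d) (r : R),
    [/\ (j <= l)%N, 0 < r, F y & (((2 `^ t) ^+ l)%:E <=
      covering_number r (eball y (2 ^+ l * r) `&` F))%E]) ->
  (t%:E <= assouad_dim F)%E.
Proof.
move=> large; apply: le_ereal_inf_tmp => _ [u [u0 [C C0 FC]] <-].
rewrite lee_fin leNgt; apply/negP => ut.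
have t0 : 0 < 2 `^ t by rewrite powR_gt0.
have q01 : 0 <= 2 `^ u / 2 `^ t < 1.
  by rewrite divr_ge0 ?powR_ge0//= ltr_pdivrMr// mul1r powR2_lt.
have [j jC] := geometric_lt C q01 ltr01.
(* The successor ensures l > 0, hence r < 2^l r. *)
have [l [y [r [jl r0 Fy cov]]]] := large j.+1.
have l0 : (0 < l)%N by apply: leq_trans jl.
have rl : 0 < r < 2 ^+ l * r.
  by rewrite r0/= ltr_pMl// exprn_egt1// ?ltr1n// -lt0n.
have := le_trans cov (FC _ _ rl _ Fy).
rewrite mulfK ?gt_eqF// -powR2_expn lee_fin => tl.
have : C * (2 `^ u / 2 `^ t) ^+ l < 1.
  apply: le_lt_trans jC; rewrite ler_wpM2l ?(ltW C0)//.
  by case/andP: q01 => q0 /ltW q1; rewrite ler_wiXn2l// ltnW.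
by rewrite expr_div_n mulrA ltr_pdivrMr ?exprn_gt0// mul1r ltNge tl.
Qed.

(** A bad P lies in all but finitely many [E j]. Each tail intersection is null, since the measures
    of the [E j] tend to 0. *)
Lemma negligible_projections k (F : set 'cV[R]_d)
    (gamma : probability (borel_mx R d) R) (s t : R) :
  (1 <= k < d)%N -> grassmannian_measure d k gamma ->
  t < s -> s < k%:R -> (s%:E < assouad_dim F)%E ->
  gamma.-negligible [set P : borel_mx R d |
    grassmannian d k P /\ ~ (t%:E <= assouad_dim (proj_image P F))%E].
Proof.
move=> kd gammaP ts sk sF; have [t0|t0] := ltP t 0.
  rewrite (_ : [set P | _] = set0); first exact: negligible_set0.
  apply/seteqP; split=> // P [_]; apply; apply: le_trans (assouad_dim_ge0 _).
  by rewrite lee_fin ltW.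
have [|K K0 good] := good_projections gammaP kd _ sk sF (t := t).
  by rewrite t0.
have [E EP] := choice good.
set q := 2 `^ t / 2 `^ s in EP.
have q01 : 0 <= q < 1.
  by rewrite divr_ge0 ?powR_ge0//= ltr_pdivrMr ?powR_gt0// mul1r powR2_lt.
apply: (@negligibleS _ _ _ _ (\bigcup_N \bigcap_(j in [set j | (N <= j)%N]) E j)).
  move=> P [GP]; apply: contra_notP => PE; apply: assouad_dim_ge => N.
  have [j Nj Ej] : exists2 j, (N <= j)%N & ~ E j P.
    apply: contrapT => nex; apply: PE; exists N => // j Nj.
    by apply: contrapT => Ej; apply: nex; exists j.
  have [_ _ /(_ P GP Ej) [l [y [r [jl r0 Fy cov]]]]] := EP j.
  by exists l, y, r; split=> //; exact: leq_trans jl.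
apply: negligible_bigcup => N; set B := \bigcap_(j in _) _.
have mB : measurable B.
  by apply: bigcap_measurable => [|j _]; [exists N => /=|case: (EP j)].
apply/negligibleP => //; apply/eqP; rewrite -measure_le0.
apply/lee_addgt0Pr => e e0; rewrite add0e.
have [j je] := geometric_lt K q01 e0.
have [mE gE _] := EP (maxn N j).
apply: (@le_trans _ _ (gamma (E (maxn N j)))).
  apply: le_measure; rewrite ?inE// => P; apply; exact: leq_maxl.
apply: (le_trans gE); rewrite lee_fin; apply: le_trans (ltW je).
rewrite ler_wpM2l ?(ltW K0)//.
by case/andP: q01 => q0 /ltW q1; rewrite ler_wiXn2l// leq_maxr.
Qed.

End AssouadDimension.

Theorem theorem2p9 (R : realType) (d k : nat) (F : set 'cV[R]_d)
    (gamma : probability (borel_mx R d) R) :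
  F !=set0 ->
  (1 <= k < d)%N ->
  grassmannian_measure d k gamma ->
  {ae gamma, forall P : 'M[R]_d, grassmannian d k P ->
    (Order.min (k%:R)%:E (assouad_dim F) <= assouad_dim (proj_image P F))%E}.
Proof.
move=> _ kd gammaP; set D := Order.min _ _.
have Dk : (D <= k%:R%:E)%E by rewrite ge_min lexx.
have DF : (D <= assouad_dim F)%E by rewrite ge_min lexx orbT.
have D0 : (0 <= D)%E by rewrite le_min assouad_dim_ge0 lee_fin ler0n.
have Dfin : D \is a fin_num by rewrite ge0_fin_numE// (le_lt_trans Dk) ?ltry.
rewrite -(fineK Dfin) in Dk DF *; set x := fine D in Dk DF *.
pose e n : R := n.+1%:R^-1; have e0 n : 0 < e n by rewrite invr_gt0.
(* Failure of the bound x means failure of some x - 1 / (n + 1), so countably many null sets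
   suffice. *)
apply: (@negligibleS _ _ _ _ (\bigcup_n [set P : borel_mx R d |
    grassmannian d k P /\ ~ ((x - e n)%:E <= assouad_dim (proj_image P F))%E])).
  move=> P /= /not_implyP[GP]; apply: contra_notP => nP.
  apply/lee_subgt0Pr => y y0.
  pose n := Num.truncn y^-1.
  have ny : e n <= y.
    rewrite -[leRHS]invrK lef_pV2 ?posrE ?invr_gt0//.
    exact/ltW/truncnS_gt.
  apply: (@le_trans _ _ (x - e n)%:E).
    by rewrite -EFinB lee_fin lerB.
  by apply: contrapT => nn; apply: nP; exists n.
apply: negligible_bigcup => n.
(* The intermediate exponent s lies strictly between t = x - e n and x, hence below both k and the
   dimension of [F]. *)
apply: (@negligible_projections _ _ _ _ _ (x - e n / 2)) => //.
- by have := e0 n; lra.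
- by move: Dk; rewrite lee_fin; have := e0 n; lra.
- by apply: lt_le_trans DF; rewrite lte_fin; have := e0 n; lra.
Qed.
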